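(* In the setting of the context (a weighted genus two admissible cover over the standard log point, with real-metrised tropicalisation $\Gamma$ and associated function $\lambda$), every connected component $\Omega$ of $\Delta^\circ=\{\lambda>0\}$ has positive genus.
   Context: *Admissible cover.* Over $\mathbb C$, let $\psi\colon(C,D_R)\to(T,D_B)$ be a hyperelliptic admissible cover: a finite degree two morphism of nodal curves, $C$ connected of arithmetic genus $2$, $T$ of genus $0$, étale on $C^{sm}\setminus D_R$, simply ramified along the six smooth points $D_R$ mapping to six distinct smooth points $D_B$, mapping nodes to nodes with the same ramification order $1$ or $2$ on both branches. It carries a weight $w\colon V(\Gamma)\to\mathbb N$ on the dual graph of $C$, not identically zero, such that with $w_T(v)=\sum_{v'\mapsto v}w(v')$ every component of $T$ with $w_T=0$ has at least three nodes or branch points. *Metric.* $\Gamma=\mathrm{trop}(C)$ and the tree $\Gamma_T=\mathrm{trop}(T)$ are the dual graphs with positive real edge lengths, where the length of an edge of $\Gamma_T$ is the ramification order (expansion factor) times the length of any edge of $\Gamma$ above it; $\mathrm{trop}(\psi)\colon\Gamma\to\Gamma_T$ is the induced harmonic map of degree two. For a subcurve, genus means arithmetic genus: first Betti number plus sum of vertex genera. *Functions.* A piecewise linear (PL) function has integral slopes on (a subdivision of) $\Gamma$ (half-integral slopes allowed on $\Gamma_T$); $\mathrm{div}(\lambda)(v)$ is the sum of outgoing slopes at $v$; $K_\Gamma(v)=2g(v)-2+\mathrm{val}(v)$. Pullback along $\mathrm{trop}(\psi)$ composes functions and multiplies divisors by local degrees. On $\Gamma_T$ let $D'(v)=\mathrm{val}(v)-2+\tfrac12\deg(D_B|_v)$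 (valence counts edges only); it has degree $1$ and pulls back to $K_\Gamma$. For each vertex $v_0$ of $\Gamma_T$ there is a PL function $\overline\lambda_T$, unique up to constants, with $D'+\mathrm{div}(\overline\lambda_T)=v_0$; its pullback to $\Gamma$ is an *admissible function*. Let $\overline\lambda_1,\dots,\overline\lambda_s$ be all of them and let $\lambda_i$ be $\overline\lambda_i$ shifted by a constant so that vertices with $\lambda_i>0$ have weight $0$ while those with $\lambda_i\ge0$ have total weight $\ge1$ (i.e. the maximum of $\lambda_i$ on vertices of positive weight is $0$). Define $\lambda=\max\{0,\lambda_1,\dots,\lambda_s\}$, a PL function on a subdivision of $\Gamma$, pulled back from $\lambda_T$ on $\Gamma_T$. Put $\Delta^\circ=\{\lambda>0\}$ and let $\Delta$ be the minimal subcurve of genus two containing the closure of $\Delta^\circ$, $\Delta_T$ its image in $\Gamma_T$. With $D'$ computed using valences in $\Delta_T$, $D=D'+\mathrm{div}(\lambda_T)$ is an effective divisor of degree $1$ on $\Delta_T$ and $\mathrm{trop}(\psi)^*D=K_\Delta+\mathrm{div}(\lambda)$ on $\Delta$. *)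

(* Defs.v *)
From HB Require Import structures.
From mathcomp Require Import all_boot all_order all_algebra.
From mathcomp Require Import all_classical all_reals all_analysis.

Set Implicit Arguments.
Unset Strict Implicit.
Unset Printing Implicit Defensive.

Import Order.TTheory GRing.Theory Num.Theory.
Import numFieldNormedType.Exports.

Local Open Scope classical_set_scope.
Local Open Scope ring_scope.

(* The orientation given by [src] and [tgt] is auxiliary. *)
Record metric_graph (R : realType) := MetricGraph {
  vertex : finType;
  edge : finType;
  src : edge -> vertex;
  tgt : edge -> vertex;
  len : edge -> R;
  len_gt0 : forall e, 0 < len e
}.

(* The underlying set of the geometric realisation: vertices, and pairs (e, t)
   with 0 < t < len e, the interior point of e at distance t from src e. *)
Definition gpoint (R : realType) (G : metric_graph R) : Type :=
  (vertex G + {x : edge G * R | 0 < x.2 < len x.1})%type.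

HB.instance Definition _ (R : realType) (G : metric_graph R) :=
  Choice.copy (gpoint G)
    (vertex G + {x : edge G * R | 0 < x.2 < len x.1})%type.

Section MetricGraph.
Context (R : realType) (G : metric_graph R).
Implicit Types (v : vertex G) (e : edge G) (f : gpoint G -> R) (W : set (gpoint G)).

Definition vtx v : gpoint G := inl v.

(* Arc-length parametrisation of e on [0, len e], extended to R by constants. *)
Definition param e (t : R) : gpoint G :=
  if insub (e, t) is Some x then inr x
  else if t <= 0 then vtx (src e) else vtx (tgt e).

(* Quotient topology of the disjoint union of the vertices and closed edges.
   Clamping R to [0, len e] is a retraction, so openness of the preimage in R
   is relative openness of the preimage in [0, len e]. *)
Definition gpoint_open W := forall e, open (param e @^-1` W).

Lemma gpoint_openT : gpoint_open setT.
Proof. by move=> e; rewrite preimage_setT; exact: openT. Qed.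

Lemma gpoint_openI : setI_closed gpoint_open.
Proof. by move=> A B oA oB e; rewrite preimage_setI; exact: openI. Qed.

Lemma gpoint_open_bigU (I : Type) (F : I -> set (gpoint G)) :
  (forall i, gpoint_open (F i)) -> gpoint_open (\bigcup_i F i).
Proof.
move=> oF e; rewrite preimage_bigcup.
by apply: bigcup_open => i _; exact: oF.
Qed.

HB.instance Definition _ :=
  isOpenTopological.Build (gpoint G) gpoint_openT gpoint_openI gpoint_open_bigU.

Definition valence v : nat := (#|[set e | src e == v]%SET| + #|[set e | tgt e == v]%SET|)%N.

(* The largest subgraph contained in a set W of points. *)
Definition verts_in W : {set vertex G} := [set v | `[< W (vtx v) >]]%SET.
Definition edges_in W : {set edge G} :=
  [set e | `[< forall t, W (param e t) >]]%SET.

Definition adj_in W : rel (vertex G) := fun u v =>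
  [exists e in edges_in W,
     ((src e == u) && (tgt e == v)) || ((src e == v) && (tgt e == u))].

(* First Betti number #E - #V + #components of the largest subgraph contained
   in W. It is that of W itself: a cycle in a graph runs through whole edges, so
   an edge that is only partly in W carries no cycle of W. *)
Definition betti1 W : int :=
  #|edges_in W|%:Z - #|verts_in W|%:Z
  + (n_comp (adj_in W) (mem (verts_in W)))%:Z.

Definition genus (g : vertex G -> nat) W : int :=
  betti1 W + (\sum_(v in verts_in W) g v)%N%:Z.

Definition graph_connected := forall u v, connect (adj_in setT) u v.

Definition is_component (U W : set (gpoint G)) :=
  exists2 p, U p & W = connected_component U p.

(* f is piecewise linear, with slopes in S, on a subdivision of G. *)
Definition is_PL (S : set R) f := forall e,
  exists (n : nat) (t c : nat -> R),
    [/\ t 0%N = 0, t n = len e &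
        forall i, (i < n)%N ->
          [/\ t i < t i.+1, S (c i) &
              forall x, t i <= x <= t i.+1 ->
                f (param e x) = f (param e (t i)) + c i * (x - t i)]].

(* Slope of f at the point param e t, in the direction of increasing (s = 1) or
   decreasing (s = -1) parameter. *)
Definition slope f e (t s : R) : R :=
  lim ((f (param e (t + s * h)) - f (param e t)) / h @[h --> 0^'+]).

Definition pl_div f (p : gpoint G) : R :=
  match p with
  | inl v => \sum_(e | src e == v) slope f e 0 1
             + \sum_(e | tgt e == v) slope f e (len e) (-1)
  | inr x => let: (e, t) := \val x in slope f e t 1 + slope f e t (-1)
  end.

End MetricGraph.

Definition half_integers (R : realType) : set R := [set c | c * 2 \is a Num.int].

(* The tropicalisation Gam -> GamT of a hyperelliptic admissible cover of genus
   two. The orientation of Gam is pulled back from that of GamT; every node of C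
   maps to a node of the tree T, so Gam has no contracted edges. *)
Record admissible_cover (R : realType) := AdmissibleCover {
  Gam : metric_graph R;
  GamT : metric_graph R;
  vgenus : vertex Gam -> nat;

  psiV : vertex Gam -> vertex GamT;
  psiE : edge Gam -> edge GamT;
  psi_src : forall e, src (psiE e) = psiV (src e);
  psi_tgt : forall e, tgt (psiE e) = psiV (tgt e);

  (* ramification order at a node, the same on both branches *)
  ram_order : edge Gam -> nat;
  ram_order12 : forall e, ram_order e = 1%N \/ ram_order e = 2%N;
  len_psi : forall e, len (psiE e) = (ram_order e)%:R * len e;

  (* degree of psi on a component of C *)
  loc_deg : vertex Gam -> nat;
  loc_deg_gt0 : forall v, (0 < loc_deg v)%N;
  loc_deg_src : forall v e', src e' = psiV v ->
    (\sum_(e | (psiE e == e') && (src e == v)) ram_order e)%N = loc_deg v;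
  loc_deg_tgt : forall v e', tgt e' = psiV v ->
    (\sum_(e | (psiE e == e') && (tgt e == v)) ram_order e)%N = loc_deg v;
  degree_two : forall v', (\sum_(v | psiV v == v') loc_deg v)%N = 2%N;

  (* components containing the six points of D_R and of D_B *)
  ram_pt : 'I_6 -> vertex Gam;
  branch_pt : 'I_6 -> vertex GamT;
  psi_ram_pt : forall i, psiV (ram_pt i) = branch_pt i;
  loc_deg_ram_pt : forall i, loc_deg (ram_pt i) = 2%N;

  (* Riemann-Hurwitz for the restriction of psi to a component of C; the
     components of T are rational *)
  riemann_hurwitz : forall v,
    (2 * vgenus v + 2 * loc_deg v =
       2 + (\sum_(e | src e == v) (ram_order e).-1
            + \sum_(e | tgt e == v) (ram_order e).-1)
       + #|[set i | ram_pt i == v]%SET|)%N;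

  Gam_connected : graph_connected Gam;
  Gam_genus : genus vgenus [set: gpoint Gam] = 2;
  GamT_connected : graph_connected GamT;
  GamT_genus : genus (fun=> 0%N) [set: gpoint GamT] = 0
}.

Section Cover.
Context (R : realType) (C : admissible_cover R).

Definition trop_psi (p : gpoint (Gam C)) : gpoint (GamT C) :=
  match p with
  | inl v => vtx (psiV v)
  | inr x => let: (e, t) := \val x in param (psiE e) ((ram_order e)%:R * t)
  end.

Definition deg_DB (v' : vertex (GamT C)) : nat :=
  #|[set i | branch_pt C i == v']%SET|.

Definition is_weight (w : vertex (Gam C) -> nat) :=
  (exists v, w v != 0%N) /\
  (forall v', (\sum_(v | psiV v == v') w v)%N = 0%N ->
     (3 <= valence v' + deg_DB v')%N).

Definition D' (p : gpoint (GamT C)) : R :=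
  match p with
  | inl v' => (valence v')%:R - 2 + (deg_DB v')%:R / 2
  | inr _ => 0
  end.

Definition solves_at (v0 : vertex (GamT C)) (f : gpoint (GamT C) -> R) :=
  is_PL (@half_integers R) f /\
  forall p, D' p + pl_div f p = (p == vtx v0)%:R.

Definition normalised (w : vertex (Gam C) -> nat) (l : gpoint (Gam C) -> R) :=
  (forall v, 0 < l (vtx v) -> w v = 0%N) /\
  (1 <= \sum_(v | (0 <= l (vtx v))%R) w v)%N.

(* [F v0] is the function on GamT whose pullback is the normalised admissible
   function lambda_i attached to the vertex v0; since the solutions for v0 differ
   by constants, such an F is unique. *)
Definition admissible_family (w : vertex (Gam C) -> nat)
    (F : vertex (GamT C) -> gpoint (GamT C) -> R) :=
  forall v0, solves_at v0 (F v0) /\ normalised w (F v0 \o trop_psi).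

Definition lambda (F : vertex (GamT C) -> gpoint (GamT C) -> R)
    (p : gpoint (Gam C)) : R :=
  \big[Num.max/0]_(v0 : vertex (GamT C)) F v0 (trop_psi p).

Definition Delta_circ (F : vertex (GamT C) -> gpoint (GamT C) -> R) :
    set (gpoint (Gam C)) := [set p | 0 < lambda F p].

End Cover.

(* Main.v *)
(** In the interior of an edge of the tree [D'] vanishes, so each admissible
    function is affine on edges; its pullback [f] to Gamma satisfies
    [K + div f >= 0], and its slopes are integral because modulo 2 the defect
    is a cycle of a tree. At every vertex [v] of [Omega] choose an [f_v]
    attaining the maximum [lambda], and sum [K + div f_v >= 0] over the vertices
    of [Omega]. On an edge inside [Omega] the two outgoing slopes add up to at
    most 0, by maximality at both ends; along a half-edge leaving [Omega] the
    chosen function drops from a positive to a nonpositive value, so its slope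
    is at most -1 and cancels the contribution of that half-edge to the valence.
    What remains is [2 (genus - #components) >= 0], and [Omega] does contain a
    vertex since an affine function positive at a point of an edge stays
    positive up to one of the ends. *)

Require Import Defs.
From mathcomp Require Import all_boot all_order all_algebra.
From mathcomp Require Import all_classical all_reals all_analysis.
From mathcomp Require Import ring lra zify.
Import Order.TTheory GRing.Theory Num.Theory.
Import numFieldNormedType.Exports.
Local Open Scope classical_set_scope.
Local Open Scope ring_scope.

(** * Metric graphs *)

Lemma param_le0 {R : realType} {G : metric_graph R} (e : edge G) (t : R) :
  t <= 0 -> param e t = vtx (src e).
Proof.
move=> t0; rewrite /param insubN ?t0 //=.
by rewrite ltNge t0.
Qed.

Lemma param_ge_len {R : realType} {G : metric_graph R} (e : edge G) (t : R) :
  len e <= t -> param e t = vtx (tgt e).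
Proof.
move=> tl; rewrite /param insubN /=; last by rewrite [t < _]ltNge tl andbF.
by rewrite leNgt (lt_le_trans (len_gt0 e) tl).
Qed.

Lemma param_inr {R : realType} {G : metric_graph R} (e : edge G) (t : R)
    (et : 0 < (e, t).2 < len (e, t).1) :
  param e t = inr (exist _ (e, t) et).
Proof.
rewrite /param; case: insubP => [x _ xE|]; last by rewrite et.
by congr inr; exact: val_inj.
Qed.

Lemma param_continuous {R : realType} {G : metric_graph R} (e : edge G) :
  continuous (param e).
Proof. by apply/continuousP => A; exact. Qed.

Lemma param_segment_connected {R : realType} {G : metric_graph R}
    (e : edge G) (a b : R) :
  connected (param e @` `[a, b]).
Proof.
apply: connected_continuous_connected; first exact: segment_connected.
by apply: continuous_subspaceT; exact: param_continuous.
Qed.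

(** The image of a segment under [param e] is connected, so if it lies in [U] and meets a component,
    that component contains it. *)
Lemma component_segment {R : realType} {G : metric_graph R}
    {U : set (gpoint G)} {p : gpoint G} {e : edge G} {a b t : R} :
  (forall x, a <= x <= b -> U (param e x)) -> a <= t <= b ->
  connected_component U p (param e t) ->
  forall x, a <= x <= b -> connected_component U p (param e x).
Proof.
move=> Uab tab ct x xab; rewrite (same_connected_component ct).
apply: (connected_component_max (B := param e @` `[a, b])).
- by exists t; rewrite //= in_itv.
- by move=> _ [y /= + <-]; rewrite in_itv; exact: Uab.
- exact: param_segment_connected.
- by exists x; rewrite //= in_itv.
Qed.

(** * Slopes and divisors of piecewise linear functions *)

Lemma slope_near {R : realType} {G : metric_graph R} (f : gpoint G -> R)
    (e : edge G) (t s k : R) :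
  (\forall h \near 0^'+, f (param e (t + s * h)) = f (param e t) + k * h) ->
  slope f e t s = k.
Proof.
move=> fk; apply: lim_near_cst; first exact: norm_hausdorff.
near=> h; have -> : f (param e (t + s * h)) = f (param e t) + k * h by near: h.
have h0 : h != 0 by apply: lt0r_neq0; near: h; exact: nbhs_right_gt.
by rewrite addrC addKr mulfK.
Unshelve. all: by end_near.
Qed.

Lemma slope_right {R : realType} {G : metric_graph R} {f : gpoint G -> R}
    {e : edge G} {a b y c : R} : a < b ->
  (forall x, a <= x <= b -> f (param e x) = y + c * x) -> slope f e a 1 = c.
Proof.
move=> ab fE; apply: slope_near; near=> h.
have h0 : 0 < h by near: h; exact: nbhs_right_gt.
have hab : h < b - a by near: h; apply: nbhs_right_lt; rewrite subr_gt0.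
by rewrite !fE; [ring|lra|lra].
Unshelve. all: by end_near.
Qed.

Lemma slope_left {R : realType} {G : metric_graph R} {f : gpoint G -> R}
    {e : edge G} {a b y c : R} : a < b ->
  (forall x, a <= x <= b -> f (param e x) = y + c * x) ->
  slope f e b (-1) = - c.
Proof.
move=> ab fE; apply: slope_near; near=> h.
have h0 : 0 < h by near: h; exact: nbhs_right_gt.
have hab : h < b - a by near: h; apply: nbhs_right_lt; rewrite subr_gt0.
by rewrite !fE; [ring|lra|lra].
Unshelve. all: by end_near.
Qed.

(** At an interior breakpoint the divisor is the jump of the slope; where it vanishes, consecutive
    pieces have equal slopes and glue. *)
Lemma is_PL_harmonic_affine {R : realType} {G : metric_graph R} {S : set R}
    {f : gpoint G -> R} {e : edge G} :
  is_PL S f -> (forall t, 0 < t < len e -> pl_div f (param e t) = 0) ->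
  exists2 c, S c &
    forall x, 0 <= x <= len e -> f (param e x) = f (vtx (src e)) + c * x.
Proof.
move=> /(_ e)[n [t [c [t0 tn tc]]]] f0.
have n0 : (0 < n)%N.
  by rewrite lt0n; apply/eqP => n0; have := len_gt0 e; rewrite -tn n0 t0 ltxx.
have tlt : forall i j, (i <= n)%N -> (j < i)%N -> t j < t i.
  elim=> // i IH j ilt; rewrite ltnS leq_eqVlt => /predU1P[->|ji].
    by case: (tc i).
  by apply: lt_trans (IH _ (ltnW ilt) ji) _; case: (tc i).
suff: forall i, (i < n)%N -> c i = c 0%N /\
    forall x, 0 <= x <= t i.+1 -> f (param e x) = f (vtx (src e)) + c 0%N * x.
  move=> /(_ n.-1); rewrite prednK // => /(_ (leqnn _))[_]; rewrite tn => fE.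
  by exists (c 0%N) => //; have [] := tc 0%N.
elim=> [|i IH] ilt.
  split=> // x; have [_ _] := tc 0%N ilt; rewrite t0 => fE /fE ->.
  by rewrite param_le0 ?subr0.
have [ci fi] := IH (ltnW ilt).
have [tii Si1 fi1] := tc _ ilt.
have ti_gt0 : 0 < t i.+1 by rewrite -t0; apply: tlt => //; exact: ltnW.
have ti_lt : t i.+1 < len e by rewrite -tn; exact: tlt.
have fti : f (param e (t i.+1)) = f (vtx (src e)) + c 0%N * t i.+1.
  by apply: fi; rewrite lexx ltW.
have ciE : c i.+1 = c 0%N.
  have et : 0 < (e, t i.+1).2 < len (e, t i.+1).1 by rewrite /= ti_gt0.
  have := f0 _ et; rewrite (param_inr e _ et) /= (slope_left ti_gt0 fi).
  (* [y] is the intercept at 0 of the line of slope [c i.+1] through the breakpoint. *)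
  rewrite (slope_right (y := f (vtx (src e)) + (c 0%N - c i.+1) * t i.+1)
                       (c := c i.+1) tii).
    by move/subr0_eq.
  by move=> x /fi1 ->; rewrite fti; ring.
split=> // x /andP[x0 xt]; have [xi|/ltW xi] := leP x (t i.+1).
  by apply: fi; rewrite x0.
by rewrite fi1 ?xi // fti ciE; ring.
Qed.

Lemma pl_div_vtx_affine {R : realType} {G : metric_graph R}
    {f : gpoint G -> R} {c : edge G -> R} :
  (forall e x, 0 <= x <= len e -> f (param e x) = f (vtx (src e)) + c e * x) ->
  forall v, pl_div f (vtx v) =
    \sum_(e | src e == v) c e - \sum_(e | tgt e == v) c e.
Proof.
move=> fE v; rewrite /= -sumrN; congr +%R; apply: eq_bigr => e _.
  exact: slope_right (len_gt0 e) (fE e).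
exact: slope_left (len_gt0 e) (fE e).
Qed.

(** * Subgraphs, Betti numbers and trees *)

Lemma adj_in_sym {R : realType} {G : metric_graph R} (W : set (gpoint G)) :
  connect_sym (adj_in W).
Proof.
apply: sym_connect_sym => u v.
by apply: eq_existsb => e; rewrite orbC.
Qed.

Lemma verts_inP {R : realType} {G : metric_graph R} {W : set (gpoint G)}
    {v : vertex G} : reflect (W (vtx v)) (v \in verts_in W).
Proof. by rewrite finset.in_set; exact: asboolP. Qed.

Lemma edges_inP {R : realType} {G : metric_graph R} {W : set (gpoint G)}
    {e : edge G} : reflect (forall t, W (param e t)) (e \in edges_in W).
Proof. by rewrite finset.in_set; exact: asboolP. Qed.

Lemma edges_in_src {R : realType} {G : metric_graph R} {W : set (gpoint G)}
    {e : edge G} : e \in edges_in W -> src e \in verts_in W.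
Proof.
by move=> /edges_inP/(_ 0) We; apply/verts_inP; rewrite -(param_le0 e 0).
Qed.

Lemma edges_in_tgt {R : realType} {G : metric_graph R} {W : set (gpoint G)}
    {e : edge G} : e \in edges_in W -> tgt e \in verts_in W.
Proof.
move=> /edges_inP/(_ (len e)) We; apply/verts_inP.
by rewrite -(param_ge_len e (len e)).
Qed.

Lemma n_comp_verts_in_gt0 {R : realType} {G : metric_graph R}
    {W : set (gpoint G)} {v : vertex G} :
  W (vtx v) -> (0 < n_comp (adj_in W) (mem (verts_in W)))%N.
Proof.
move=> Wv; apply/card_gt0P; exists (fingraph.root (adj_in W) v).
have cl : closed_mem (adj_in W) (mem (verts_in W)).
  apply: (intro_closed (adj_in_sym W)) => x y /existsP[e /andP[eW]].
  by case/orP => /andP[/eqP<- /eqP<-] _; rewrite ?edges_in_src ?edges_in_tgt.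
apply/andP; split; first exact: (roots_root (adj_in_sym W)).
by rewrite /= -(closed_connect cl (connect_root (adj_in W) v)); apply/verts_inP.
Qed.

(** Genus zero reads #E - #V + #components = 0, and [v] provides at least one component. *)
Lemma tree_card {R : realType} {G : metric_graph R} (v : vertex G) :
  genus (fun=> 0%N) [set: gpoint G] = 0 -> (#|edge G| < #|vertex G|)%N.
Proof.
rewrite /genus /betti1 big1 // addr0.
have := @n_comp_verts_in_gt0 _ _ [set: gpoint G] v I.
have -> : edges_in [set: gpoint G] = [set: edge G]%SET.
  by apply/setP => e; rewrite finset.in_setT; apply/edges_inP.
have -> : verts_in [set: gpoint G] = [set: vertex G]%SET.
  by apply/setP => v'; rewrite finset.in_setT; apply/verts_inP.
by rewrite !cardsT; lia.
Qed.

(* The incidence matrix of a connected graph has corank at most one: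
   a function on the vertices killed by every edge is constant. *)
Lemma tree_cycle_eq0 {R : realType} {G : metric_graph R} {K : fieldType}
    {x : edge G -> K} :
  graph_connected G -> genus (fun=> 0%N) [set: gpoint G] = 0 ->
  (forall v, \sum_(e | src e == v) x e - \sum_(e | tgt e == v) x e = 0) ->
  forall e, x e = 0.
Proof.
move=> Gc Gg x0 e0.
pose B : 'M[K]_(#|edge G|, #|vertex G|) := \matrix_(i, j)
  ((src (enum_val i) == enum_val j)%:R - (tgt (enum_val i) == enum_val j)%:R).
have ker1 : (kermx B^T <= const_mx (m := 1) (n := #|vertex G|) 1)%MS.
  apply/rV_subP => u /sub_kermxP uB.
  have ue e : u 0 (enum_rank (src e)) = u 0 (enum_rank (tgt e)).
    have /rowP /(_ (enum_rank e)) := uB; rewrite !mxE.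
    under eq_bigr do rewrite !mxE enum_rankK mulrBr.
    rewrite sumrB (bigD1 (enum_rank (src e))) //= enum_rankK eqxx mulr1.
    rewrite big1 ?addr0; last first.
      move=> i; apply: contraNeq; rewrite mulf_eq0 negb_or => /andP[_].
      by case: (src e =P _) => [->|]; rewrite ?enum_valK ?eqxx.
    rewrite (bigD1 (enum_rank (tgt e))) //= enum_rankK eqxx mulr1.
    rewrite big1 ?addr0; first by move/subr0_eq.
    move=> i; apply: contraNeq; rewrite mulf_eq0 negb_or => /andP[_].
    by case: (tgt e =P _) => [->|]; rewrite ?enum_valK ?eqxx.
  have uc v w : u 0 (enum_rank v) = u 0 (enum_rank w).
    have /connectP[p] := Gc v w.
    elim: p v => [|y p IH] v /=; first by move=> _ ->.
    case/andP=> /existsP[e /andP[_ /orP[]/andP[/eqP eu /eqP ev]]] yp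
      /(IH _ yp) <-.
      by rewrite -eu -ev.
    by rewrite -eu -ev.
  (* A constant row is its value at any vertex, here [src e0], times the all-ones row. *)
  apply/submxP; exists (u 0 (enum_rank (src e0)))%:M.
  apply/rowP => i; rewrite mul_scalar_mx !mxE mulr1.
  by rewrite -[i in LHS]enum_valK; exact: uc.
(* The rank of [B] is at least #V - 1, hence at least #E, its number of rows. *)
have Bfree : row_free B.
  have := mxrankS ker1; rewrite mxrank_ker mxrank_tr => /leq_trans.
  move=> /(_ _ (rank_leq_row _)); have := rank_leq_row B.
  by have := tree_card (src e0) Gg; rewrite /row_free; lia.
have /(row_free_inj Bfree) : (\row_i x (enum_val i)) *m B = 0 *m B.
  rewrite mul0mx; apply/rowP => j; rewrite !mxE -[RHS](x0 (enum_val j)).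
  under eq_bigr do rewrite !mxE mulrBr !mulr_natr !mulrb.
  rewrite sumrB -!big_mkcond /=; congr (_ - _);
    by rewrite [RHS](reindex _ (onW_bij _ (@enum_val_bij (edge G)))).
by move/rowP/(_ (enum_rank e0)); rewrite !mxE enum_rankK.
Qed.

Lemma valenceE {R : realType} {G : metric_graph R} {K : pzSemiRingType}
    (v : vertex G) :
  (valence v)%:R = \sum_(e | src e == v) 1 + \sum_(e | tgt e == v) 1 :> K.
Proof.
rewrite /valence natrD !sumr_const; congr (_%:R + _%:R);
  by apply: eq_card => e; rewrite finset.in_set.
Qed.

Definition canonical_div {R : realType} {G : metric_graph R}
  (g : vertex G -> nat) (v : vertex G) : R := 2 * (g v)%:R - 2 + (valence v)%:R.

Lemma edges_in_component {R : realType} {G : metric_graph R}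
    {U : set (gpoint G)} {p : gpoint G} {e : edge G} {t : R} :
  (forall x, 0 <= x <= len e -> U (param e x)) -> 0 <= t <= len e ->
  connected_component U p (param e t) ->
  e \in edges_in (connected_component U p).
Proof.
move=> Ue te cp; apply/edges_inP => x; have el := ltW (len_gt0 e).
have cpe := component_segment Ue te cp.
have [x0|/ltW x0] := leP x 0.
  by rewrite param_le0 // -(param_le0 e 0) //; apply: cpe; rewrite lexx.
have [xl|/ltW xl] := leP (len e) x; last by apply: cpe; rewrite x0.
rewrite param_ge_len // -(param_ge_len e (len e)) //.
by apply: cpe; rewrite lexx andbT.
Qed.

(** * Maxima of edgewise affine functions *)

Section MaxOfAffine.
Context {R : realType} {G : metric_graph R} {I : finType}.
Context (f : I -> gpoint G -> R) (a : I -> edge G -> R).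
Context (a_int : forall i e, a i e \is a Num.int).
Context (fE : forall i e x, 0 <= x <= len e ->
  f i (param e x) = f i (vtx (src e)) + a i e * x).

Let U : set (gpoint G) := [set p | exists i, 0 < f i p].

Lemma max_affine_tgt i e :
  f i (vtx (tgt e)) = f i (vtx (src e)) + a i e * len e.
Proof.
by rewrite -(param_ge_len e (len e)) // fE // lexx ltW // len_gt0.
Qed.

Lemma max_affine_component_vtx p : U p ->
  exists v, connected_component U p (vtx v).
Proof.
case: p => [v|[[e t] et]] Up.
  by exists v; apply: connected_component_refl.
have [i] := Up; rewrite -(param_inr e t et) in Up * => fi.
have /= /andP[t0 tl] := et.
have ct : connected_component U (param e t) (param e t).
  exact: connected_component_refl.
have fit : f i (param e t) = f i (vtx (src e)) + a i e * t.
  by apply: fE; rewrite !ltW.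
have [ai|ai] := leP (a i e) 0.
  exists (src e); rewrite -(param_le0 e 0) //.
  apply: (@component_segment _ _ _ _ _ 0 t t) ct _ _ => [x /andP[x0 xt]||].
  - exists i; rewrite fE ?x0 ?(le_trans xt (ltW tl)) //.
    rewrite fit in fi; apply: lt_le_trans fi _.
    by rewrite lerD2l ler_wnM2l.
  - by rewrite lexx ltW.
  - by rewrite lexx ltW.
exists (tgt e); rewrite -(param_ge_len e (len e)) //.
apply: (@component_segment _ _ _ _ _ t (len e) t) ct _ _ => [x /andP[tx xl]||].
- exists i; rewrite fE ?xl ?(le_trans (ltW t0) tx) //.
  rewrite fit in fi; apply: lt_le_trans fi _.
  by rewrite lerD2l ler_wpM2l // ltW.
- by rewrite lexx ltW.
- by rewrite lexx ltW.
Qed.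

(* A positive function of the family that does not drop along the edge keeps
   the whole edge inside U; otherwise it drops by an integral, hence at least
   unit, slope. *)
Lemma max_affine_cut_src p i e : connected_component U p (vtx (src e)) ->
  0 < f i (vtx (src e)) -> e \notin edges_in (connected_component U p) ->
  a i e <= -1.
Proof.
move=> ce fi; apply: contraR; rewrite -ltNge => ai.
have {}ai : 0 <= a i e.
  have /intrP[n an] := a_int i e; move: ai.
  by rewrite an ler0z -[-1]/((-1)%:~R) ltr_int; lia.
apply: (@edges_in_component _ _ _ _ _ 0) => [x /andP[x0 xl]||].
- by exists i; rewrite fE ?x0 // ltr_wpDr // mulr_ge0.
- by rewrite lexx ltW // len_gt0.
- by rewrite param_le0.
Qed.

Lemma max_affine_cut_tgt p i e : connected_component U p (vtx (tgt e)) ->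
  0 < f i (vtx (tgt e)) -> e \notin edges_in (connected_component U p) ->
  1 <= a i e.
Proof.
move=> ce fi; apply: contraR; rewrite -ltNge => ai.
have {}ai : a i e <= 0.
  by have /intrP[n an] := a_int i e; move: ai; rewrite an lerz0 ltrz1; lia.
apply: (@edges_in_component _ _ _ _ _ (len e)) => [x /andP[x0 xl]||].
- exists i; rewrite fE ?x0 //; rewrite max_affine_tgt in fi.
  by apply: lt_le_trans fi _; rewrite lerD2l ler_wnM2l.
- by rewrite lexx andbT ltW // len_gt0.
- by rewrite param_ge_len.
Qed.

Lemma max_affine_component_genus (g : vertex G -> nat) p :
  (forall i v, 0 <= canonical_div g v +
     (\sum_(e | src e == v) a i e - \sum_(e | tgt e == v) a i e)) ->
  U p -> 0 < genus g (connected_component U p).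
Proof.
move=> aK Up; set W := connected_component U p.
have [v0 Wv0] := max_affine_component_vtx _ Up.
(* [m v] indexes a function attaining the maximum at [v]; [Up] supplies the starting index for the
   arg max. *)
have /choice[m mP] (v : vertex G) : exists i,
    forall j, f j (vtx v) <= f i (vtx v).
  have [i _] := Up; exists [arg max_(j > i) f j (vtx v)]%O.
  by case: arg_maxP => // j _ H k; exact: H.
have m_gt0 v : W (vtx v) -> 0 < f (m v) (vtx v).
  move=> /connected_component_sub[i fi]; exact: lt_le_trans fi (mP v i).
(* [A e] and [B e] are the contributions of the half-edges of [e] at its source and target: 1 from
   the valence plus the outgoing slope of the function chosen there. *)
pose A e : R := (src e \in verts_in W)%:R * (1 + a (m (src e)) e).
pose B e : R := (tgt e \in verts_in W)%:R * (1 - a (m (tgt e)) e).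
have AB e : A e + B e <= 2 * (e \in edges_in W)%:R.
  rewrite /A /B; have [eW|eW] := boolP (e \in edges_in W).
    rewrite edges_in_src ?edges_in_tgt //.
    (* Each chosen function is the larger one at its own end, so the one chosen at the source cannot
       have the greater slope. *)
    suff : a (m (src e)) e <= a (m (tgt e)) e by rewrite /=; lra.
    rewrite -(ler_pM2r (len_gt0 e)).
    have := mP (src e) (m (tgt e)); have := mP (tgt e) (m (src e)).
    by rewrite !max_affine_tgt; lra.
  rewrite /= mulr0 -[leRHS]addr0; apply: lerD.
    case: verts_inP => [Wv|_]; rewrite ?mul0r // mul1r.
    by have := max_affine_cut_src _ _ _ Wv (m_gt0 _ Wv) eW; lra.
  case: verts_inP => [Wv|_]; rewrite ?mul0r // mul1r.
  by have := max_affine_cut_tgt _ _ _ Wv (m_gt0 _ Wv) eW; lra.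
have sumA : \sum_(v in verts_in W) \sum_(e | src e == v) (1 + a (m v) e)
    = \sum_e A e.
  rewrite /A; under [RHS]eq_bigr do rewrite mulrC mulr_natr mulrb.
  rewrite -big_mkcond /= [RHS](partition_big (@src _ G) (mem (verts_in W))) //=.
  apply: eq_bigr => v vW; apply: eq_big => [e|e /eqP-> //].
  by case: (src e =P v) => [->|]; rewrite ?vW ?andbF.
have sumB : \sum_(v in verts_in W) \sum_(e | tgt e == v) (1 - a (m v) e)
    = \sum_e B e.
  rewrite /B; under [RHS]eq_bigr do rewrite mulrC mulr_natr mulrb.
  rewrite -big_mkcond /= [RHS](partition_big (@tgt _ G) (mem (verts_in W))) //=.
  apply: eq_bigr => v vW; apply: eq_big => [e|e /eqP-> //].
  by case: (tgt e =P v) => [->|]; rewrite ?vW ?andbF.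
have : 0 <= \sum_(v in verts_in W) (2 * (g v)%:R - 2) +
    (\sum_e A e + \sum_e B e).
  rewrite -sumA -sumB -!big_split /=; apply: sumr_ge0 => v _.
  have := aK (m v) v; rewrite /canonical_div valenceE.
  by rewrite !big_split /= sumrN; lra.
have : \sum_e A e + \sum_e B e <= 2 * #|edges_in W|%:R.
  rewrite -big_split /= -sum1_card natr_sum mulr_sumr [leRHS]big_mkcond /=.
  apply: ler_sum => e _; apply: le_trans (AB e) _.
  by case: ifP => _; rewrite ?mulr0.
have -> : \sum_(v in verts_in W) (2 * (g v)%:R - 2) =
    2 * (\sum_(v in verts_in W) g v)%N%:R - 2 * #|verts_in W|%:R :> R.
  rewrite sumrB -mulr_sumr natr_sum sumr_const -mulr_natr; ring.
have := n_comp_verts_in_gt0 Wv0; rewrite /genus /betti1 -/W.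
move: #|_| (#|_|) (\sum_(v in _) _)%N (n_comp _ _) => nv ne ng k k0 h1 h2.
(* This makes the genus [ne - nv + k + ng] at least the number [k] of components, which is
   positive. *)
have : (nv%:R <= ng%:R + ne%:R :> R) by lra.
by rewrite -natrD ler_nat; lia.
Qed.

End MaxOfAffine.

(** * Admissible covers *)

Lemma trop_psi_param {R : realType} {C : admissible_cover R}
    (e : edge (Gam C)) (x : R) :
  trop_psi (param e x) = param (psiE e) ((ram_order e)%:R * x).
Proof.
have r0 : 0 < (ram_order e)%:R :> R by case: (ram_order12 e) => ->.
have [x0|x0] := leP x 0.
  by rewrite !param_le0 /= ?psi_src // pmulr_rle0.
have [xl|xl] := leP (len e) x.
  by rewrite !param_ge_len /= ?psi_tgt // len_psi ler_pM2l.
have ex : 0 < (e, x).2 < len (e, x).1 by rewrite /= x0.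
by rewrite (param_inr e x ex).
Qed.

Lemma sum_src_psi {R : realType} {C : admissible_cover R} {K : pzSemiRingType}
    (c : edge (GamT C) -> K) (v : vertex (Gam C)) :
  \sum_(e | src e == v) (ram_order e)%:R * c (psiE e) =
  (loc_deg v)%:R * \sum_(e' | src e' == psiV v) c e'.
Proof.
rewrite (partition_big (@psiE R C) (fun e' => src e' == psiV v)) /=; last first.
  by move=> e /eqP <-; rewrite psi_src.
rewrite mulr_sumr; apply: eq_bigr => e' /eqP e'v.
rewrite -(loc_deg_src e'v) natr_sum mulr_suml.
by apply: eq_big => [e|e /andP[_ /eqP ->]//]; rewrite andbC.
Qed.

Lemma sum_tgt_psi {R : realType} {C : admissible_cover R} {K : pzSemiRingType}
    (c : edge (GamT C) -> K) (v : vertex (Gam C)) :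
  \sum_(e | tgt e == v) (ram_order e)%:R * c (psiE e) =
  (loc_deg v)%:R * \sum_(e' | tgt e' == psiV v) c e'.
Proof.
rewrite (partition_big (@psiE R C) (fun e' => tgt e' == psiV v)) /=; last first.
  by move=> e /eqP <-; rewrite psi_tgt.
rewrite mulr_sumr; apply: eq_bigr => e' /eqP e'v.
rewrite -(loc_deg_tgt e'v) natr_sum mulr_suml.
by apply: eq_big => [e|e /andP[_ /eqP ->]//]; rewrite andbC.
Qed.

Lemma loc_deg_fibre {R : realType} {C : admissible_cover R}
    {u v : vertex (Gam C)} :
  psiV u = psiV v -> u != v -> (loc_deg u + loc_deg v = 2)%N.
Proof.
move=> uv neq; have := degree_two (psiV v).
rewrite (bigD1 v) //= (bigD1 u) /=; last by rewrite uv eqxx.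
by have := loc_deg_gt0 u; have := loc_deg_gt0 v; lia.
Qed.

(** A vertex carrying a ramification point has local degree 2, so it is alone in its fibre and
    carries every point of [D_R] above its image. A vertex without such points makes both sides
    0. *)
Lemma card_ram_pt {R : realType} {C : admissible_cover R} (v : vertex (Gam C)) :
  (2 * #|[set i | ram_pt C i == v]%SET| = loc_deg v * deg_DB (psiV v))%N.
Proof.
have branch_ram i : branch_pt C i = psiV v -> ram_pt C i = v.
  rewrite -psi_ram_pt => /loc_deg_fibre iv; apply/eqP; apply: contraT => /iv.
  by rewrite loc_deg_ram_pt; have := loc_deg_gt0 v; lia.
have -> : deg_DB (psiV v) = #|[set i | ram_pt C i == v]%SET|.
  apply: eq_card => i; rewrite !finset.in_set.
  by apply/eqP/eqP => [/branch_ram|<-] //; rewrite psi_ram_pt.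
have [-> |] := posnP #|[set i | ram_pt C i == v]%SET|; first by rewrite !muln0.
move=> /card_gt0P[i]; rewrite finset.in_set => /eqP <-.
by rewrite loc_deg_ram_pt.
Qed.

(** Riemann-Hurwitz at [v]: summing [ram_order - 1] over the half-edges gives the local degree times
    the valence below, minus the valence of [v], and [card_ram_pt] converts ramification points into
    branch points. *)
Lemma canonical_pullback {R : realType} {C : admissible_cover R}
    (v : vertex (Gam C)) :
  canonical_div (@vgenus R C) v = (loc_deg v)%:R * D' (vtx (psiV v)).
Proof.
have ram_pred (P : pred (edge (Gam C))) :
    \sum_(e | P e) (ram_order e).-1%:R =
    \sum_(e | P e) (ram_order e)%:R * 1 - \sum_(e | P e) 1 :> R.
  rewrite -sumrB; apply: eq_bigr => e _.
  by case: (ram_order12 e) => ->; rewrite /= mulr1 ?subrr // [2]mulr2n addrK.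
have /(congr1 (fun n => n%:R : R)) := riemann_hurwitz v.
have /(congr1 (fun n => n%:R : R)) := card_ram_pt v.
rewrite !natrD !natrM !natr_sum.
rewrite !ram_pred (sum_src_psi (fun=> 1)) (sum_tgt_psi (fun=> 1)).
rewrite /canonical_div /= !valenceE.
move: (loc_deg v)%:R (vgenus v)%:R (deg_DB _)%:R => l g b.
move: (\sum_(e | _) 1) (\sum_(e | _) 1) (\sum_(e | _) 1) (\sum_(e | _) 1).
move: (#|_|%:R) => n a1 a2 a3 a4 h1 h2.
by lra.
Qed.

Lemma solves_at_slopes {R : realType} {C : admissible_cover R}
    {v0 : vertex (GamT C)} {f : gpoint (GamT C) -> R} :
  solves_at v0 f -> exists c : edge (GamT C) -> R,
  [/\ forall e, half_integers (c e),
      forall e x, 0 <= x <= len e -> f (param e x) = f (vtx (src e)) + c e * x &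
      forall v, D' (vtx v) +
        (\sum_(e | src e == v) c e - \sum_(e | tgt e == v) c e) = (v == v0)%:R].
Proof.
move=> [fPL fD].
have f0 e t : 0 < t < len e -> pl_div f (param e t) = 0.
  move=> et; have := fD (param e t).
  have et' : 0 < (e, t).2 < len (e, t).1 by [].
  by rewrite (param_inr e t et') add0r.
have /choice[c cP] : forall e, exists c, half_integers c /\
    forall x, 0 <= x <= len e -> f (param e x) = f (vtx (src e)) + c * x.
  by move=> e; have [c] := is_PL_harmonic_affine fPL (f0 e); exists c.
have cE e := proj2 (cP e).
exists c; split=> [e|//|v]; first by case: (cP e).
by rewrite -(pl_div_vtx_affine cE) fD.
Qed.

(** * Parity and integrality of slopes *)

Lemma ram_order_fibre {R : realType} {C : admissible_cover R}
    (e' : edge (GamT C)) :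
  (\sum_(e | psiE e == e') ram_order e)%N = 2%N.
Proof.
rewrite -(degree_two (src e')).
rewrite (partition_big (@src _ (Gam C)) (fun v => psiV v == src e')) /=.
  by apply: eq_bigr => v /eqP vE; rewrite loc_deg_src.
by move=> e /eqP <-; rewrite psi_src.
Qed.

Lemma ram_order_unramified {R : realType} {C : admissible_cover R}
    {e d : edge (Gam C)} :
  ram_order e = 1%N -> psiE d = psiE e -> ram_order d = 1%N.
Proof.
move=> e1 de; have [<- //|neq] := eqVneq e d.
have := ram_order_fibre (psiE e).
rewrite (bigD1 e) //= (bigD1 d) /=; last by rewrite de eqxx eq_sym.
by case: (ram_order12 d); lia.
Qed.

Lemma sum_fibre_comp {I J K : finType} (f : I -> J) (g : J -> K)
    (F : I -> nat) (k : K) :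
  (\sum_(j | g j == k) \sum_(i | f i == j) F i =
   \sum_(i | g (f i) == k) F i)%N.
Proof.
rewrite [RHS](partition_big f (fun j => g j == k)) //.
apply: eq_bigr => j /eqP <-; apply: eq_bigl => i.
by case: (f i =P j) => [->|]; rewrite ?eqxx ?andbF.
Qed.

Lemma deg_DB_fibre {R : realType} {C : admissible_cover R}
    (v' : vertex (GamT C)) :
  (deg_DB v' = \sum_(v | psiV v == v') #|[set i | ram_pt C i == v]%SET|)%N.
Proof.
under eq_bigr do rewrite cardsE -sum1_card.
rewrite (sum_fibre_comp (ram_pt C)) /deg_DB cardsE -sum1_card.
by apply: eq_bigl => i; rewrite psi_ram_pt.
Qed.

(* By Riemann-Hurwitz a vertex of the tree carries as many branch points,
   modulo 2, as ramified half-edges, so the reductions of 2 c and of the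
   indicator of ramified edges differ by a cycle of the tree. *)
Lemma slope_parity {R : realType} {C : admissible_cover R}
    {v0 : vertex (GamT C)} {c : edge (GamT C) -> R} {z : edge (GamT C) -> int} :
  (forall e, c e * 2 = (z e)%:~R) ->
  (forall v, D' (vtx v) +
    (\sum_(e | src e == v) c e - \sum_(e | tgt e == v) c e) = (v == v0)%:R) ->
  forall e', (z e')%:~R =
    (\sum_(e | psiE e == e') (ram_order e).-1)%N%:R :> 'F_2.
Proof.
move=> cz cD.
have F2N (a : 'F_2) : - a = a by apply: oppr_pchar2; exact: pchar_Fp.
have F20 : 2 = 0 :> 'F_2 by exact: pchar_Fp_0.
have F20z : (2 : int)%:~R = 0 :> 'F_2 by exact: F20.
have zc (P : pred (edge (GamT C))) :
    \sum_(e | P e) (z e)%:~R = (\sum_(e | P e) c e) * 2.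
  by rewrite mulr_suml; apply: eq_bigr => e _; rewrite cz.
(* The orders above [e'] add up to 2, so [d e'] is 1 if the edge above is ramified and 0 if there
   are two unramified ones. *)
pose d (e' : edge (GamT C)) : 'F_2 :=
  (\sum_(e | psiE e == e') (ram_order e).-1)%N%:R.
(* Twice the divisor equation has integral terms; modulo 2 signs disappear and only the branch
   points remain. *)
have zv v : \sum_(e | src e == v) (z e)%:~R + \sum_(e | tgt e == v) (z e)%:~R
    = (deg_DB v)%:R :> 'F_2.
  have : (\sum_(e | src e == v) z e - \sum_(e | tgt e == v) z e
      = 2 * ((v == v0)%:Z - (valence v)%:Z + 2) - (deg_DB v)%:Z)%R.
    apply: (@intr_inj R); have := cD v; rewrite {1}/D' /=.
    move: (valence v) (deg_DB v) => n b.
    rewrite !(rmorphB, rmorphD, rmorphM, rmorph_sum) /=.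
    rewrite !zc -!pmulrn.
    by case: (v == v0) => /=; lra.
  move=> /(congr1 (fun m : int => m%:~R : 'F_2)).
  rewrite !rmorphB rmorphM /= F20z mul0r sub0r !rmorph_sum /= F2N => ->.
  exact: F2N.
(* Riemann-Hurwitz modulo 2, summed over the vertices above [v']. *)
have dv (v' : vertex (GamT C)) :
    \sum_(e' | src e' == v') d e' + \sum_(e' | tgt e' == v') d e'
    = (deg_DB v')%:R.
  rewrite -!natr_sum !sum_fibre_comp.
  under eq_bigl do rewrite psi_src.
  under [X in _ + X%:R = _]eq_bigl do rewrite psi_tgt.
  rewrite -(sum_fibre_comp (@src _ (Gam C))) -(sum_fibre_comp (@tgt _ (Gam C))).
  rewrite -natrD -big_split /= deg_DB_fibre !natr_sum.
  apply: eq_bigr => v _; have := riemann_hurwitz v.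
  move=> /(congr1 (fun n => n%:R : 'F_2)).
  rewrite -mulnDr natrM F20 mul0r !natrD F20 add0r => /esym/eqP.
  by rewrite addr_eq0 F2N => /eqP.
move=> e'; apply/eqP; rewrite -subr_eq0; apply/eqP; move: e'.
apply: (tree_cycle_eq0 (@GamT_connected _ C) (@GamT_genus _ C)) => v.
by rewrite F2N !sumrB addrACA -opprD dv zv subrr.
Qed.

(** A ramified edge doubles the half-integral slope. Below an unramified edge no edge of the fibre
    is ramified, so by [slope_parity] twice the slope is even. *)
Lemma pullback_slope_int {R : realType} {C : admissible_cover R}
    {v0 : vertex (GamT C)} {c : edge (GamT C) -> R} :
  (forall e, half_integers (c e)) ->
  (forall v, D' (vtx v) +
    (\sum_(e | src e == v) c e - \sum_(e | tgt e == v) c e) = (v == v0)%:R) ->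
  forall e, (ram_order e)%:R * c (psiE e) \is a Num.int.
Proof.
move=> chalf cD e.
have /choice[z cz] e' : exists m : int, c e' * 2 = m%:~R by apply/intrP/chalf.
have [e1|e2] := ram_order12 e; last by rewrite e2 mulrC; exact: chalf.
have := slope_parity cz cD (psiE e).
rewrite big1 => [|d /eqP de]; last by rewrite (ram_order_unramified e1 de).
rewrite e1 mul1r => z0; have /dvdzP[q zq] : (2 %| z (psiE e))%Z.
  move: z0; case: (z (psiE e)) => n /eqP.
    by rewrite -pmulrn -(dvdn_pcharf (pchar_Fp (isT : prime 2))).
  by rewrite NegzE mulrNz oppr_eq0 -pmulrn
    -(dvdn_pcharf (pchar_Fp (isT : prime 2))).
have := cz (psiE e); rewrite zq rmorphM /= => /mulIf -> //.
Qed.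

(** Pullback multiplies slopes by [ram_order] and divisors by [loc_deg], so K + div is [loc_deg v]
    at the vertices [v] above [v0] and 0 at the others. *)
Lemma admissible_slopes {R : realType} {C : admissible_cover R}
    {w : vertex (Gam C) -> nat} {F : vertex (GamT C) -> gpoint (GamT C) -> R} :
  admissible_family w F -> exists a : vertex (GamT C) -> edge (Gam C) -> R,
  [/\ forall v0 e, a v0 e \is a Num.int,
      forall v0 e x, 0 <= x <= len e ->
        F v0 (trop_psi (param e x)) =
        F v0 (trop_psi (vtx (src e))) + a v0 e * x &
      forall v0 v, 0 <= canonical_div (@vgenus R C) v +
        (\sum_(e | src e == v) a v0 e - \sum_(e | tgt e == v) a v0 e)].
Proof.
move=> hF.
have /choice[c cP] v0 := solves_at_slopes (proj1 (hF v0)).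
exists (fun v0 e => (ram_order e)%:R * c v0 (psiE e)).
split=> [v0 e|v0 e x /andP[x0 xl]|v0 v].
- by have [chalf _ cD] := cP v0; exact: pullback_slope_int chalf cD e.
- have [_ cE _] := cP v0.
  rewrite trop_psi_param cE ?psi_src; first by rewrite mulrCA mulrA.
  by rewrite mulr_ge0 //= len_psi ler_wpM2l.
- have [_ _ cD] := cP v0.
  rewrite canonical_pullback sum_src_psi sum_tgt_psi -mulrBr -mulrDr cD.
  by rewrite mulr_ge0.
Qed.

Theorem lemma3p17 (R : realType) (C : admissible_cover R)
    (w : vertex (Gam C) -> nat) (hw : is_weight w)
    (F : vertex (GamT C) -> gpoint (GamT C) -> R)
    (hF : admissible_family w F)
    (Omega : set (gpoint (Gam C)))
    (hOmega : is_component (Delta_circ F) Omega) :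
  0 < genus (@vgenus R C) Omega.
Proof.
have [a [a_int aE aK]] := admissible_slopes hF.
(* The maximum defining [lambda] starts from 0, so it is positive exactly when some member of the
   family is. *)
have UE : Delta_circ F = [set p | exists v0, 0 < F v0 (trop_psi p)].
  apply/seteqP; split=> p /=.
    by move=> /bigmax_gtP[|[v0 _ ?]]; [rewrite ltxx|exists v0].
  by move=> [v0 Fp]; apply/bigmax_gtP; right; exists v0.
have [p Up ->] := hOmega; rewrite UE in Up *.
exact: (@max_affine_component_genus _ _ _ (fun v0 => F v0 \o @trop_psi R C) a).
Qed.
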